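(* For $n\in\mathbb{N}$, $\mathcal{F}_n$ is equal to the number of lattice points in $H_{1,n}$ minus the number of lattice points in $H_{2,n}$, where for $H_{1,n}$ all points on the boundary are included except for those on the boundary curve $xy=n/2$, and for $H_{2,n}$ all points on the boundary are included. That is, $$\mathcal{F}_n=\#\{(x,y)\in\mathbb{Z}^2 : x,y\ge 1,\ n/2<xy\le n\}-\#\{(x,y)\in\mathbb{Z}^2 : x,y\ge 1,\ xy\le n/2\}.$$
   Context: $\mathbb{N}$ denotes the set of positive integers. For $n\in\mathbb{N}$, $\mathcal{F}_n = \#\{k\in\mathbb{Z} : 1\le k\le n,\ \lfloor n/k\rfloor\text{ is odd}\}$, where $\lfloor\cdot\rfloor$ is the floor function. $H_{1,n}$ is the hyperbolic region in the $xy$-plane with $x,y\ge 1$ bounded by the hyperbolas $xy=n$ and $xy=n/2$. $H_{2,n}$ is the region in the $xy$-plane bounded by the lines $x=1$, $y=1$ and the hyperbola $xy=n/2$ (i.e. the points with $x,y\ge1$ and $xy\le n/2$). Lattice points are points of $\mathbb{Z}^2$. *)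

(* Defs.v *)
From HB Require Import structures.
From mathcomp Require Import all_boot all_order all_algebra finmap.
From mathcomp Require Import all_classical all_reals.

Set Implicit Arguments.
Unset Strict Implicit.
Unset Printing Implicit Defensive.

Import Order.TTheory GRing.Theory Num.Theory.
Local Open Scope classical_set_scope.
Local Open Scope ring_scope.

(* [fset_set A] is empty when [A] is infinite, so this is the cardinal of [A]
   only for finite [A]; the sets counted below are shown to be finite. *)
Definition ncard (T : choiceType) (A : set T) : nat := #|` fset_set A|.

Definition odd_quotients (n : nat) : set int :=
  [set k | 1 <= k <= n%:Z /\ ~~ (2 %| Num.floor (n%:R / k%:~R : rat))%Z].

Definition calF (n : nat) : nat := ncard (odd_quotients n).

(* The boundary of [H1] is included except for the points of xy = n/2. *)
Definition H1 (R : realType) (n : nat) : set (R * R) :=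
  [set p | [/\ 1 <= p.1, 1 <= p.2 & n%:R / 2 < p.1 * p.2 <= n%:R]].

Definition H2 (R : realType) (n : nat) : set (R * R) :=
  [set p | [/\ 1 <= p.1, 1 <= p.2 & p.1 * p.2 <= n%:R / 2]].

Definition lattice_points (R : realType) (D : set (R * R)) : set (int * int) :=
  [set p | D (p.1%:~R, p.2%:~R)].

Lemma finite_int_itv (n : nat) : finite_set [set k : int | 1 <= k <= n%:Z].
Proof.
apply: (@sub_finite_set _ _ (Posz @` `I_n.+1)); last exact/finite_image/finite_II.
by case=> [k|k] //= /andP[_ kn]; exists k.
Qed.

Lemma finite_odd_quotients (n : nat) : finite_set (odd_quotients n).
Proof. by apply: sub_finite_set (finite_int_itv n) => k []. Qed.

Lemma finite_hyperbolic (n : nat) (A : set (int * int)) :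
  (forall p, A p -> [/\ 1 <= p.1, 1 <= p.2 & p.1 * p.2 <= n%:Z]) ->
  finite_set A.
Proof.
move=> An; apply: sub_finite_set (finite_setX (finite_int_itv n) (finite_int_itv n)).
move=> [x y] /An[/= x1 y1 xyn]; split=> /=; rewrite ?x1 ?y1 /=.
  by apply: le_trans xyn; rewrite ler_peMr // (le_trans _ x1).
by apply: le_trans xyn; rewrite ler_peMl // (le_trans _ y1).
Qed.

Lemma finite_lattice_points_H1 (R : realType) (n : nat) :
  finite_set (lattice_points (@H1 R n)).
Proof.
apply: (@finite_hyperbolic n) => -[x y] [/= x1 y1 /andP[_]].
by rewrite -intrM (ler_int R _ n%:Z) !ler1z in x1 y1 *.
Qed.

Lemma finite_lattice_points_H2 (R : realType) (n : nat) :
  finite_set (lattice_points (@H2 R n)).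
Proof.
apply: (@finite_hyperbolic n) => -[x y] [/= x1 y1 xyn].
have {xyn} : x%:~R * y%:~R <= n%:R :> R.
  by apply: (le_trans xyn); rewrite ler_pdivrMr // ler_peMr // ler1n.
by rewrite -intrM (ler_int R _ n%:Z) !ler1z in x1 y1 *.
Qed.

(* Main.v *)
(* Row by row: for x >= 1, with q = n %/ x, the points (x, y) with xy <= n/2
   number q./2 and those with n/2 < xy <= n number q - q./2; the difference
   q - 2 q./2 is 1 if q is odd and 0 otherwise. *)
Require Import Defs.
From HB Require Import structures.
From mathcomp Require Import all_boot all_order all_algebra finmap.
From mathcomp Require Import all_classical all_reals.
From mathcomp Require Import zify.
Set Implicit Arguments.
Unset Strict Implicit.
Unset Printing Implicit Defensive.
Import Order.TTheory GRing.Theory Num.Theory.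
Local Open Scope classical_set_scope.
Local Open Scope ring_scope.

(** An image of a finite type is the set of an explicit [fset], so [fset_set] does not fall back to
    the empty default and [ncard] becomes a cardinal that a sum over ordinals can compute. *)
Lemma ncard_image (T : finType) (U : choiceType) (f : T -> U) (P : pred T) :
  injective f -> ncard (f @` [set x | P x]) = #|P|.
Proof.
move=> f_inj; rewrite /ncard.
have -> : f @` [set x | P x] = [set` [fset f x | x in P]%fset].
  apply/seteqP; split=> [_ [x Px <-]|_ /imfsetP[x Px ->]]; last by exists x.
  by apply/imfsetP; exists x.
by rewrite set_fsetK card_imfset //= cardE.
Qed.

Lemma sum_leq_ord (q n : nat) :
  (\sum_(y < n.+1) (0 < y <= q)%N = minn q n)%N.
Proof. by elim: n => [|n IHn]; rewrite big_ord_recr /= ?big_ord0 ?IHn; lia. Qed.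

(** The field is left arbitrary because the comparison with n/2 occurs both in [R] and in [rat];
    clearing the denominator gives the same integer condition. *)
Lemma half_lt_intr (K : numFieldType) (n : nat) (m : int) :
  (n%:R / 2 < m%:~R :> K) = (n%:Z < 2 * m).
Proof. by rewrite ltr_pdivrMr // -(ltr_int K) intrM mulrC. Qed.

Lemma le_half_intr (K : numFieldType) (n : nat) (m : int) :
  (m%:~R <= n%:R / 2 :> K) = (2 * m <= n%:Z).
Proof. by rewrite ler_pdivlMr // -(ler_int K) intrM mulrC. Qed.

Lemma floor_divn (n k : nat) : (0 < k)%N ->
  Num.floor (n%:R / k%:R : rat) = (n %/ k)%N.
Proof.
move=> k0; apply: floor_def; rewrite ler_pdivlMr ?ltr0n // ltr_pdivrMr ?ltr0n //.
rewrite -[k%:R]/(k%:Z%:~R) -[n%:R]/(n%:Z%:~R) -!intrM ler_int ltr_int.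
have := divn_eq n k; have := ltn_pmod n k0; nia.
Qed.

Lemma calFE (n : nat) :
  calF n = (\sum_(x < n.+1) ((0 < x) && odd (n %/ x)))%N.
Proof.
pose P (x : 'I_n.+1) := (0 < x)%N && odd (n %/ x).
rewrite -big_mkcond /= sum1_card -(@ncard_image _ _ (fun x : 'I_n.+1 => x%:Z) P);
  last by move=> x y [/val_inj].
have oddE k : (0 < k)%N ->
    (~~ (2 %| Num.floor (n%:R / (k%:Z)%:~R : rat))%Z) = odd (n %/ k).
  by move=> k0; rewrite floor_divn // dvdzE dvdn2 negbK.
congr ncard; apply/seteqP; split => [[k|k] //= [/andP[k1 kn]] //|_ [x /andP[x0 xo] <-]].
  rewrite oddE // => ko; have kn1 : (k < n.+1)%N by lia.
  by exists (Ordinal kn1) => //=; apply/andP.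
split; last by rewrite oddE.
by have := ltn_ord x; lia.
Qed.

(** Coordinates that are at least 1 with product at most n are themselves at most n, so the pairs of
    ordinals below n + 1 reach every point of [A]. *)
Lemma ncard_pairs (n : nat) (A : set (int * int)) (P : nat -> nat -> bool) :
  (forall p, A p -> [/\ 1 <= p.1, 1 <= p.2 & p.1 * p.2 <= n%:Z]) ->
  (forall x y : nat, A (x%:Z, y%:Z) <-> P x y) ->
  ncard A = (\sum_(x < n.+1) \sum_(y < n.+1) P x y)%N.
Proof.
move=> An AP; rewrite pair_big /=.
pose f (p : 'I_n.+1 * 'I_n.+1) := (p.1%:Z, p.2%:Z).
pose Q (p : 'I_n.+1 * 'I_n.+1) := P p.1 p.2.
rewrite -big_mkcond /= sum1_card -(@ncard_image _ _ f Q); last first.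
  by move=> [x y] [x' y'] [/val_inj -> /val_inj ->].
congr ncard; apply/seteqP; split => [[x y] Axy|_ [p /AP ? <-]//].
have [/= x1 y1 xyn] := An _ Axy.
case: x y x1 y1 xyn Axy => // x [y|] // x1 y1 xyn /AP Pxy.
have xn : (x < n.+1)%N by nia.
have yn : (y < n.+1)%N by nia.
by exists (Ordinal xn, Ordinal yn).
Qed.

(** Stated as a sum because subtraction on [nat] truncates. *)
Lemma odd_quotient_rows (n : nat) :
  (\sum_(x < n.+1) \sum_(y < n.+1) [&& 0 < x, 0 < y, n < 2 * (x * y) & x * y <= n]
   = \sum_(x < n.+1) ((0 < x) && odd (n %/ x))
   + \sum_(x < n.+1) \sum_(y < n.+1) [&& 0 < x, 0 < y & 2 * (x * y) <= n])%N.
Proof.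
rewrite -big_split; apply: eq_bigr => -[[|x] /= xn] _.
  (* The row x = 0 contributes nothing on either side. *)
  by rewrite !big1.
set q := (n %/ x.+1)%N.
have qn : (q <= n)%N by exact: leq_div.
(* Iterated division by x + 1 and k is division by their product; k = 2 gives the lower region, k =
   1 the whole row. *)
have rowE k (y : 'I_n.+1) : ((0 < k) ->
    (k * (x.+1 * y) <= n) = (y <= q %/ k))%N.
  by move=> k0; rewrite /q -divnMA leq_divRL ?muln_gt0 //; congr (_ <= _)%N; lia.
have half : (\sum_(y < n.+1) [&& 0 < y & 2 * (x.+1 * y) <= n] = q./2)%N.
  under eq_bigr do rewrite rowE // divn2.
  by rewrite sum_leq_ord; lia.
have full : (\sum_(y < n.+1) (0 < y <= q)%N = q)%N by rewrite sum_leq_ord; lia.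
(* Adding the lower count to both sides completes the left one to the whole row, of size q, while
   the right one becomes [odd q] plus twice [q./2], again q. *)
rewrite half; apply: (@addIn q./2); rewrite -{1}half -big_split /=.
transitivity q; last by have := odd_double_half q; lia.
rewrite -[RHS]full; apply: eq_bigr => y _.
by have := rowE 1%N y isT; rewrite mul1n divn1 => <-; lia.
Qed.

Theorem proposition2p3 (R : realType) (n : nat) (n_gt0 : (0 < n)%N) :
  (calF n)%:Z = (ncard (lattice_points (@H1 R n)))%:Z
              - (ncard (lattice_points (@H2 R n)))%:Z
  /\
  (calF n)%:Z =
    (ncard [set p : int * int | [/\ 1 <= p.1, 1 <= p.2 &
       n%:R / 2 < (p.1 * p.2)%:~R :> rat /\ p.1 * p.2 <= n%:Z]])%:Z
  - (ncard [set p : int * int | [/\ 1 <= p.1, 1 <= p.2 &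
       (p.1 * p.2)%:~R <= n%:R / 2 :> rat]])%:Z.
Proof.
(* Real and rational conditions reduce to the same integer inequalities, so the two conjuncts become
   one equation. *)
have -> : lattice_points (@H1 R n) = [set p : int * int | [/\ 1 <= p.1, 1 <= p.2 &
    n%:R / 2 < (p.1 * p.2)%:~R :> rat /\ p.1 * p.2 <= n%:Z]].
  apply/seteqP; split => -[x y] /=; rewrite /lattice_points /H1 /= -intrM;
    rewrite !ler1z !half_lt_intr (ler_int R _ n%:Z).
    by move=> [-> -> /andP].
  by move=> [-> -> /andP].
have -> : lattice_points (@H2 R n) = [set p : int * int | [/\ 1 <= p.1, 1 <= p.2 &
    (p.1 * p.2)%:~R <= n%:R / 2 :> rat]].
  by apply/seteqP; split => -[x y] /=;
    rewrite /lattice_points /H2 /= -intrM !ler1z !le_half_intr.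
set A := [set p : int * int | _]; set B := [set p : int * int | _].
suff eqF : (calF n)%:Z = (ncard A)%:Z - (ncard B)%:Z by [].
have -> : ncard A = (\sum_(x < n.+1) \sum_(y < n.+1)
    [&& 0 < x, 0 < y, n < 2 * (x * y) & x * y <= n])%N.
  apply: (@ncard_pairs _ _ (fun x y => [&& 0 < x, 0 < y, n < 2 * (x * y) & x * y <= n])%N)
    => [p [? ? []] //|x y]; rewrite /A /= half_lt_intr.
  split=> [[? ? [? ?]]|]; first by apply/and4P; split; lia.
  by case/and4P => *; split; [lia|lia|split; lia].
have -> : ncard B = (\sum_(x < n.+1) \sum_(y < n.+1)
    [&& 0 < x, 0 < y & 2 * (x * y) <= n])%N.
  apply: (@ncard_pairs _ _ (fun x y => [&& 0 < x, 0 < y & 2 * (x * y) <= n])%N)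
    => [p [p1 p2]|x y]; rewrite /B /= le_half_intr.
    by move=> pn; split=> //; nia.
  split=> [[? ? ?]|]; first by apply/and3P; split; lia.
  by case/and3P => *; split; lia.
by rewrite odd_quotient_rows -calFE PoszD addrK.
Qed.
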